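(* Let $0<\delta<1$ and $\alpha\ge0$, and let $u_h^0,\dots,u_h^N\in D(A)_h$ be given by the scheme for the Navier-Stokes-Voight equations: $u_h^0$ is the $L^2(\Omega)$-orthogonal projection of $u_0$ onto $D(A)_h$ and, for $m=1,\dots,N$, when $u_h^0,\dots,u_h^{m-1}$ are known, $u_h^m\in D(A)_h$ is the solution of $$\frac1k(u_h^m-u_h^{m-1},v_h)+\frac{\alpha^2}{k}(A_hu_h^m-A_hu_h^{m-1},v_h)+\nu((u_h^{m-1},v_h))_h+b_h(u_h^{m-1},u_h^{m-1},v_h)=(f^m,v_h)\quad\text{for all }v_h\in V_h .$$ Set $$d_6=|u_0|^2+\alpha^2\|u_0\|^2+\left(\frac{d_0^2}{\nu}+4T\right)\int_0^T|f(s)|^2\,ds .$$ Assume that $k$ and $h$ satisfy (1) $kS^2(h)\le\dfrac{1-\delta}{4\nu}$, (2) $kS_1^2(h)\le\dfrac{\nu\delta}{8d_6}$. Then the $u_h^m$ remain bounded in the following sense: $$|u_h^m|^2+\alpha^2\|u_h^m\|_h^2\le d_6,\qquad m=1,\dots,N,$$ $$k\sum_{m=1}^r\|u_h^{m-1}\|_h^2\le\frac{2d_6}{\nu\delta},\qquad r=1,\dots,N,$$ $$\sum_{m=1}^N\left(|u_h^m-u_h^{m-1}|^2+\alpha^2\|u_h^m-u_h^{m-1}\|_h^2\right)\le\left(\frac{2-\delta}{\delta}\right)d_6+4T\int_0^T|f(s)|^2\,ds .$$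
   Context: Let $L>0$, $\Omega=[0,2\pi L]^2$, with periodic boundary conditions; all functions are $\mathbb{R}^2$-valued with zero mean. $(\cdot,\cdot)$ and $|\cdot|$ are the $L^2(\Omega)$ inner product and norm. $H$ and $V$ are the closures in $L^2$ and $H^1$ of the divergence-free, zero-mean, vector trigonometric polynomials on $\Omega$; $\|u\|=|\nabla u|$ is the norm of $V$. $A=-P_\sigma\Delta$ is the Stokes operator ($P_\sigma$ the Helmholtz-Leray projection onto $H$), with domain $D(A)=(H^2(\Omega))^2\cap V$. $\nu>0$ is the viscosity, $\alpha$ the regularization length scale, $u_0\in V$ the initial velocity, $T>0$, and $f\in L^2(0,T;L^2(\Omega))$ the forcing. Galerkin spaces: for $h\in\mathbb{N}$, $V_h$ is an increasing sequence of finite-dimensional subspaces of $V$ with union dense in $V$, and $D(A)_h$ is an increasing sequence of finite-dimensional subspaces of $D(A)$ with union dense in $D(A)$, with $D(A)_h\subset V_h\subset L^2(\Omega)$. $V_h$ carries an inner product $((\cdot,\cdot))_h$ with norm $\|\cdot\|_h$, in addition to $|\cdot|$. There are a constant $d_0$ independent of $h$ and a number $S(h)$ (the stability constant) with $$|u_h|\le d_0\|u_h\|_h,\qquad \|u_h\|_h\le S(h)|u_h|\qquad\text{for all }u_h\in V_h .$$ $A_h:D(A)_h\to D(A)_h$ is the discrete Stokes operator, $(A_hu_h,v_h)=((u_h,v_h))_h$ for all $u_h,v_h\in D(A)_h$; with a constant $d_2$ independent of $h$ and a generic constant $c$, $\|u_h\|_h\le d_2|A_hu_h|$ and $|A_hu_h|\le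 cS(h)\|u_h\|_h$ for all $u_h\in D(A)_h$. $b_h$ is a trilinear continuous form on $V_h$ such that, with a constant $d_1$ and a number $S_1(h)\le d_1S^2(h)$, for all $u_h,v_h,w_h\in V_h$: $b_h(u_h,v_h,v_h)=0$; $|b_h(u_h,v_h,w_h)|\le d_1\|u_h\|_h\|v_h\|_h\|w_h\|_h$; $|b_h(u_h,u_h,v_h)|\le S_1(h)|u_h|\,\|u_h\|_h\,|v_h|$. Time discretization: $N\ge1$ is an integer, $k=T/N$, and $f^m=\frac1k\int_{(m-1)k}^{mk}f(t)\,dt\in L^2(\Omega)$ for $m=1,\dots,N$. The projected initial datum is assumed to satisfy $\|u_h^0\|_h\le\|u_0\|$. *)

(* Defs.v *)
From mathcomp Require Import all_boot all_order all_algebra.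
From mathcomp Require Import all_classical all_reals all_analysis.
Set Implicit Arguments.
Unset Strict Implicit.
Unset Printing Implicit Defensive.
Import Order.TTheory GRing.Theory Num.Theory.
Import numFieldNormedType.Exports.
Local Open Scope classical_set_scope.
Local Open Scope ring_scope.

(* A vector field is a pair of square-integrable scalar functions on R * R,
   integrated over Omega = [0, 2 pi L]^2 only.  Elements of vfield L are
   representatives: two of them define the same element of L^2(Omega)^2 iff
   L2norm (u - v) = 0.  Every notion below is insensitive to the choice of the
   representative, and sets of fields that stand for subspaces of L^2 are
   required to be saturated for this relation (see subspace). *)

Section Fields.
Context {R : realType} (L : R).

Definition Omega : set (R * R) :=
  `[0, 2 * pi * L]%classic `*` `[0, 2 * pi * L]%classic.

Lemma measurable_Omega :
  measurable (Omega : set (measurableTypeR R * measurableTypeR R)).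
Proof. by apply: measurableX; exact: measurable_itv. Qed.

Definition muOmega : {measure set (measurableTypeR R * measurableTypeR R) -> \bar R} :=
  mrestr (lebesgue_measure \x lebesgue_measure)%E measurable_Omega.

Definition sfield := LfunType muOmega (lee1n 2).
Definition vfield := (sfield * sfield)%type.

Definition L2ip (u v : vfield) : R :=
  \int[muOmega]_z (u.1 z * v.1 z + u.2 z * v.2 z).
Definition L2norm (u : vfield) : R := Num.sqrt (L2ip u u).

Definition zero_mean (u : vfield) : Prop :=
  \int[muOmega]_z (u.1 z) = 0 /\ \int[muOmega]_z (u.2 z) = 0.

(* D i j is the derivative of order i in the first variable and j in the second
   one of the periodic C^oo function D 0 0. *)
Definition test_function (D : nat -> nat -> R * R -> R) : Prop :=
  [/\ forall i j, continuous (D i j),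
      forall i j x y, is_derive x (1 : R) (fun s => D i j (s, y)) (D i.+1 j (x, y)),
      forall i j x y, is_derive y (1 : R) (fun s => D i j (x, s)) (D i j.+1 (x, y)),
      forall x y, D 0%N 0%N (x + 2 * pi * L, y) = D 0%N 0%N (x, y)
    & forall x y, D 0%N 0%N (x, y + 2 * pi * L) = D 0%N 0%N (x, y)].

(* Weak derivatives on the torus. *)
Definition weak_dx1 (g dg : sfield) : Prop :=
  forall D, test_function D ->
    \int[muOmega]_z (g z * D 1%N 0%N z) = - \int[muOmega]_z (dg z * D 0%N 0%N z).
Definition weak_dy1 (g dg : sfield) : Prop :=
  forall D, test_function D ->
    \int[muOmega]_z (g z * D 0%N 1%N z) = - \int[muOmega]_z (dg z * D 0%N 0%N z).

Definition weak_dx (u du : vfield) : Prop :=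
  weak_dx1 u.1 du.1 /\ weak_dx1 u.2 du.2.
Definition weak_dy (u du : vfield) : Prop :=
  weak_dy1 u.1 du.1 /\ weak_dy1 u.2 du.2.

Definition in_H1 (u : vfield) : Prop :=
  exists ux uy, weak_dx u ux /\ weak_dy u uy.
Definition in_H2 (u : vfield) : Prop :=
  exists ux uy, [/\ weak_dx u ux, weak_dy u uy, in_H1 ux & in_H1 uy].

(* Meaningful on H^1, where weak derivatives exist and are unique (a.e.). *)
Definition dx (u : vfield) : vfield := xget 0 [set g | weak_dx u g].
Definition dy (u : vfield) : vfield := xget 0 [set g | weak_dy u g].
Definition Vnorm (u : vfield) : R :=
  Num.sqrt (L2norm (dx u) ^+ 2 + L2norm (dy u) ^+ 2).
Definition H1norm (u : vfield) : R := Num.sqrt (L2norm u ^+ 2 + Vnorm u ^+ 2).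

Definition trig_poly (p : R * R -> R) : Prop :=
  exists (n : nat) (kappa : 'I_n -> int * int) (a b : 'I_n -> R),
    forall z, p z = \sum_(i < n)
      let theta := ((kappa i).1%:~R * z.1 + (kappa i).2%:~R * z.2) / L in
      a i * cos theta + b i * sin theta.

Definition divfree_trig_poly (w : vfield) : Prop :=
  exists p1 p2 : R * R -> R,
    [/\ trig_poly p1, trig_poly p2,
        forall z, 'D_((1, 0) : R * R) p1 z + 'D_((0, 1) : R * R) p2 z = 0,
        zero_mean w
      & {ae muOmega, forall z, w.1 z = p1 z /\ w.2 z = p2 z}].

Definition in_H (u : vfield) : Prop :=
  forall e : R, 0 < e -> exists2 w, divfree_trig_poly w & L2norm (u - w) < e.
Definition in_V (u : vfield) : Prop :=
  in_H1 u /\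
  forall e : R, 0 < e -> exists2 w, divfree_trig_poly w & H1norm (u - w) < e.
Definition in_DA (u : vfield) : Prop := in_H2 u /\ in_V u.

Definition is_orth_proj (W : set vfield) (u p : vfield) : Prop :=
  W p /\ forall w, W w -> L2ip (u - p) w = 0.

Definition is_laplacian (u l : vfield) : Prop :=
  exists ux uy uxx uyy, [/\ weak_dx u ux, weak_dy u uy,
    weak_dx ux uxx, weak_dy uy uyy & l = uxx + uyy].

(* g = A u = - P_sigma (Laplacian u) *)
Definition is_stokes (u g : vfield) : Prop :=
  exists2 l, is_laplacian u l & is_orth_proj in_H (- l) g.

Definition subspace (W : set vfield) : Prop :=
  [/\ W 0,
      forall (a : R) u v, W u -> W v -> W (a *: u + v)
    & forall u v, W u -> L2norm (u - v) = 0 -> W v].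

Definition fin_dim (W : set vfield) : Prop :=
  exists (n : nat) (e : 'I_n -> vfield), forall u, W u ->
    exists c : 'I_n -> R, L2norm (u - \sum_(i < n) c i *: e i) = 0.

Definition bilinear_on (W : set vfield) (a : vfield -> vfield -> R) : Prop :=
  (forall v, W v -> forall (c : R) u u', W u -> W u' ->
     a (c *: u + u') v = c * a u v + a u' v) /\
  (forall u, W u -> forall (c : R) v v', W v -> W v' ->
     a u (c *: v + v') = c * a u v + a u v').

Definition inner_product_on (W : set vfield) (a : vfield -> vfield -> R) : Prop :=
  [/\ bilinear_on W a,
      forall u v, W u -> W v -> a u v = a v u,
      forall u, W u -> 0 <= a u u
    & forall u, W u -> a u u = 0 -> L2norm u = 0].

Definition trilinear_on (W : set vfield) (b : vfield -> vfield -> vfield -> R) : Prop :=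
  (forall u, W u -> bilinear_on W (b u)) /\
  (forall w, W w -> bilinear_on W (fun u v => b u v w)).

(* Bochner integration of vfield-valued functions of time.  A simple function is
   a finite sequence of pairs (A, c), standing for the sum of the 1_A c. *)

Definition simple (s : seq (set (measurableTypeR R) * vfield)) : Prop :=
  {in s, forall p, measurable p.1}.
Definition simple_val (s : seq (set (measurableTypeR R) * vfield)) (t : R) : vfield :=
  \sum_(p <- s) (\1_(p.1) t : R) *: p.2.
Definition simple_int (I : set (measurableTypeR R))
    (s : seq (set (measurableTypeR R) * vfield)) : vfield :=
  \sum_(p <- s) fine (lebesgue_measure (p.1 `&` I)) *: p.2.

Definition strongly_measurable (I : set R) (f : R -> vfield) : Prop :=
  exists2 s, (forall n, simple (s n)) &
    forall t, I t -> L2norm (f t - simple_val (s n) t) @[n --> \oo] --> (0 : R).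

(* For I of finite measure, and f strongly measurable and integrable on I. *)
Definition is_bochner_int (I : set R) (f : R -> vfield) (J : vfield) : Prop :=
  exists s,
    [/\ forall n, simple (s n),
        (\int[lebesgue_measure]_(t in I) (L2norm (f t - simple_val (s n) t))%:E)%E
          @[n --> \oo] --> 0%E
      & L2norm (J - simple_int I (s n)) @[n --> \oo] --> (0 : R)].
Definition bochner_int (I : set R) (f : R -> vfield) : vfield :=
  xget 0 [set J | is_bochner_int I f J].

(* f is in L^2(0, T; L^2(Omega)), the fields having zero mean.  A class of
   functions that agree for a.e. t is given by a representative that is a
   pointwise limit of simple functions. *)
Definition in_L2L2 (T : R) (f : R -> vfield) : Prop :=
  [/\ strongly_measurable `[0, T] f,
      (\int[lebesgue_measure]_(t in `[0%R, T]) (L2norm (f t) ^+ 2)%:E < +oo)%E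
    & forall t, 0 <= t <= T -> zero_mean (f t)].

(* f^m, the mean value of f over ((m - 1) k, m k) *)
Definition time_average (k : R) (f : R -> vfield) (m : nat) : vfield :=
  k^-1 *: bochner_int `[m.-1%:R * k, m%:R * k] f.

End Fields.

(* The constants d0, d1, d2, c do not depend on h.  The forms ((.,.))_h, b_h and
   the operator A_h are total functions of which only the restrictions to V_h,
   resp. D(A)_h, are constrained.  The bound bh_le_normh is the continuity of b_h. *)
Record galerkin (R : realType) (L : R) := Galerkin {
  Vh : nat -> set (vfield L);
  DAh : nat -> set (vfield L);
  iph : nat -> vfield L -> vfield L -> R;
  Ah : nat -> vfield L -> vfield L;
  bh : nat -> vfield L -> vfield L -> vfield L -> R;
  d0 : R; d1 : R; d2 : R; cA : R;
  Sh : nat -> R;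
  S1h : nat -> R;
  normh := fun h u => Num.sqrt (iph h u u);

  Vh_subspace : forall h, subspace (Vh h);
  Vh_fin_dim : forall h, fin_dim (Vh h);
  Vh_V : forall h, Vh h `<=` @in_V R L;
  Vh_incr : forall h, Vh h `<=` Vh h.+1;
  Vh_dense : forall u, in_V u -> forall e : R, 0 < e ->
    exists h w, Vh h w /\ Vnorm (u - w) < e;

  DAh_subspace : forall h, subspace (DAh h);
  DAh_fin_dim : forall h, fin_dim (DAh h);
  DAh_DA : forall h, DAh h `<=` @in_DA R L;
  DAh_incr : forall h, DAh h `<=` DAh h.+1;
  (* density for the graph norm of the Stokes operator *)
  DAh_dense : forall u, in_DA u -> forall e : R, 0 < e ->
    exists h w g, [/\ DAh h w, is_stokes (u - w) g,
                      L2norm (u - w) < e & L2norm g < e];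
  DAh_Vh : forall h, DAh h `<=` Vh h;

  iph_inner : forall h, inner_product_on (Vh h) (iph h);
  L2norm_le_normh : forall h u, Vh h u -> L2norm u <= d0 * normh h u;
  normh_le_L2norm : forall h u, Vh h u -> normh h u <= Sh h * L2norm u;

  Ah_DAh : forall h u, DAh h u -> DAh h (Ah h u);
  AhE : forall h u v, DAh h u -> DAh h v -> L2ip (Ah h u) v = iph h u v;
  normh_le_Ah : forall h u, DAh h u -> normh h u <= d2 * L2norm (Ah h u);
  Ah_le_normh : forall h u, DAh h u -> L2norm (Ah h u) <= cA * Sh h * normh h u;

  bh_trilinear : forall h, trilinear_on (Vh h) (bh h);
  S1h_le : forall h, S1h h <= d1 * Sh h ^+ 2;
  bh_skew : forall h u v, Vh h u -> Vh h v -> bh h u v v = 0;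
  bh_le_normh : forall h u v w, Vh h u -> Vh h v -> Vh h w ->
    `|bh h u v w| <= d1 * normh h u * normh h v * normh h w;
  bh_le_L2norm : forall h u v, Vh h u -> Vh h v ->
    `|bh h u u v| <= S1h h * L2norm u * normh h u * L2norm v
}.

(* Main.v *)
Require Import Defs.
From mathcomp Require Import all_boot all_order all_algebra.
From mathcomp Require Import all_classical all_reals all_analysis.
From mathcomp Require Import measurable_realfun ring lra.
Set Implicit Arguments.
Unset Strict Implicit.
Unset Printing Implicit Defensive.
Import Order.TTheory GRing.Theory Num.Theory.
Import numFieldNormedType.Exports.
Local Open Scope classical_set_scope.
Local Open Scope ring_scope.

(** The proof is a discrete energy argument.  Write p, w for two consecutive
    iterates, x = |w - p| and E(v) = |v|^2 + alpha^2 ||v||_h^2.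

    Testing the scheme with 2 k w, polarization of both inner products turns the
    difference quotients into E(w) - E(p) + E(w - p).  The viscous and convective
    terms are explicit: they act on p, so that the viscous term gives the
    dissipation 2 k nu ||p||_h^2 plus a perturbation involving w - p, and the skew
    symmetry of b_h leaves only b_h(p, p, w - p).  Each of the three terms
    against w - p (viscous, convective, force) costs x^2 / 4 by Young's
    inequality; the bound on k S(h)^2 makes the rest of the viscous one at most
    k nu (1 - delta) ||p||_h^2, and the bound on k S_1(h)^2, together with
    |p|^2 <= d6, makes the rest of the convective one at most
    k nu (delta / 2) ||p||_h^2.  The force against p consumes a further
    k nu ||p||_h^2, and k nu (delta / 2) ||p||_h^2 of the dissipation is left
    ([energy_step]).  Summing these inequalities gives the first two bounds, in an
    induction where the bound E <= d6 at one step is what controls the convective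
    term at the next.

    The third bound does not follow with its constants from the same inequality,
    where the coefficient of x^2 is only 1 / 4.  It comes from testing
    with 2 k (w - p): then x^2 appears with the coefficient 2, of which the same
    three Young inequalities consume 3 / 4 ([increment_step]), and the sum of
    k ||p||_h^2 is already under control.

    Finally the sum of k |f^m|^2 is at most the integral of |f|^2 over [0, T]
    ([sum_time_average_le]).  This is Jensen's inequality for Bochner integrals,
    proved from their definition by approximation with simple functions. *)

(** * Semi-inner products on a subspace *)

Section InnerProduct.
Context {R : realType} (L : R) (W : set (vfield L)).
Context (a : vfield L -> vfield L -> R).
Context (sW : Defs.subspace W) (aP : inner_product_on W a).
Local Notation norm u := (Num.sqrt (a u u)).

Lemma subspaceZD c u v : W u -> W v -> W (c *: u + v).
Proof. by case: sW => _ h _; exact: h. Qed.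

Lemma subspaceB u v : W u -> W v -> W (u - v).
Proof.
move=> Wu Wv; have := subspaceZD (-1) Wv Wu.
by rewrite scaleN1r addrC.
Qed.

Lemma ipC u v : W u -> W v -> a u v = a v u.
Proof. by case: aP => _ h _ _; exact: h. Qed.

Lemma ip_ge0 u : W u -> 0 <= a u u.
Proof. by case: aP => _ _ h _; exact: h. Qed.

Lemma ipZDl c u u' v : W u -> W u' -> W v ->
  a (c *: u + u') v = c * a u v + a u' v.
Proof. by case: aP => -[h _] _ _ _ Wu Wu' Wv; exact: h. Qed.

Lemma ipZDr c u u' v : W u -> W u' -> W v ->
  a v (c *: u + u') = c * a v u + a v u'.
Proof. by case: aP => -[_ h] _ _ _ Wu Wu' Wv; exact: h. Qed.

Lemma ipBl u u' v : W u -> W u' -> W v -> a (u - u') v = a u v - a u' v.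
Proof.
by move=> Wu Wu' Wv; rewrite -scaleN1r addrC ipZDl// mulN1r addrC.
Qed.

Lemma ipBr u u' v : W u -> W u' -> W v -> a v (u - u') = a v u - a v u'.
Proof.
by move=> Wu Wu' Wv; rewrite -scaleN1r addrC ipZDr// mulN1r addrC.
Qed.

Lemma norm_sqr u : W u -> norm u ^+ 2 = a u u.
Proof. by move=> Wu; rewrite sqr_sqrtr// ip_ge0. Qed.

(** The form may be degenerate, so the case a v v = 0 is separate: there
    a (u + t v) (u + t v) is affine in t and can only be nonnegative if
    a u v = 0. *)
Lemma ip_CauchySchwarz u v : W u -> W v -> `|a u v| <= norm u * norm v.
Proof.
move=> Wu Wv; have := ip_ge0 Wu; have := ip_ge0 Wv => v0 u0.
suff h : a u v ^+ 2 <= a u u * a v v.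
  by rewrite -sqrtr_sqr -sqrtrM// ler_wsqrtr.
have key t : 0 <= a u u + 2 * t * a u v + t ^+ 2 * a v v.
  have := ip_ge0 (subspaceZD t Wv Wu).
  rewrite ipZDl//; last exact: subspaceZD.
  by rewrite !ipZDr// (ipC Wv Wu); lra.
have [v_eq0|v_neq0] := eqVneq (a v v) 0.
  rewrite v_eq0 mulr0; apply: contraT; rewrite -ltNge => h.
  have nz : a u v != 0 by apply: contraTneq h => ->; rewrite expr0n ltxx.
  (* this t makes the affine function equal to -1 *)
  have := key (- (a u u + 1) / (2 * a u v)).
  rewrite v_eq0 mulr0 addr0.
  have -> : 2 * (- (a u u + 1) / (2 * a u v)) * a u v = - (a u u + 1).
    by field.
  lra.
have vpos : 0 < a v v by rewrite lt_def v_neq0.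
(* the minimizer of the quadratic polynomial in t *)
have := key (- a u v / a v v).
have -> : a u u + 2 * (- a u v / a v v) * a u v + (- a u v / a v v) ^+ 2 * a v v
   = (a u u * a v v - a u v ^+ 2) / a v v by field.
by rewrite pmulr_lge0 ?invr_gt0// subr_ge0.
Qed.

Lemma normD_le u v : W u -> W v -> norm (u + v) <= norm u + norm v.
Proof.
move=> Wu Wv; have Wuv : W (u + v) by have := subspaceZD 1 Wu Wv; rewrite scale1r.
rewrite -(@ler_pXn2r _ 2)// ?nnegrE ?addr_ge0 ?sqrtr_ge0// norm_sqr//.
have -> : a (u + v) (u + v) = a u u + 2 * a u v + a v v.
  have := ipZDl 1 Wu Wv Wuv; have := ipZDr 1 Wu Wv Wu; have := ipZDr 1 Wu Wv Wv.
  by rewrite scale1r !mul1r (ipC Wv Wu) => -> -> ->; lra.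
rewrite sqrrD !norm_sqr//.
have := ip_CauchySchwarz Wu Wv; have := ler_norm (a u v); lra.
Qed.

(** The polarization identity that makes an implicit Euler difference quotient
    tested with the new iterate telescope. *)
Lemma ip_increment u v : W u -> W v ->
  2 * a (u - v) u = norm u ^+ 2 - norm v ^+ 2 + norm (u - v) ^+ 2.
Proof.
move=> Wu Wv; have Wuv := subspaceB Wu Wv.
rewrite !norm_sqr// (ipBr Wu Wv Wuv) (ipBl Wu Wv Wu) (ipBl Wu Wv Wv) (ipC Wv Wu).
lra.
Qed.

End InnerProduct.

(** * The inner product of square-integrable fields *)

Section L2.
Context {R : realType} (L : R).
Implicit Types u v w : vfield L.

Lemma integrable_sfieldM (g g' : sfield L) :
  (muOmega L).-integrable setT (EFin \o (fun z => g z * g' z)).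
Proof.
by apply/Lfun1_integrable; apply: (Lfun2_mul_Lfun1 (LfunP _) (LfunP _)).
Qed.

Lemma L2ipE u v : L2ip u v =
  \int[muOmega L]_z (u.1 z * v.1 z) + \int[muOmega L]_z (u.2 z * v.2 z).
Proof. by rewrite /L2ip RintegralD//; exact: integrable_sfieldM. Qed.

Lemma Rintegral_sfieldZDl c (g g' k : sfield L) :
  \int[muOmega L]_z ((c *: g + g') z * k z) =
  c * \int[muOmega L]_z (g z * k z) + \int[muOmega L]_z (g' z * k z).
Proof.
rewrite -RintegralZl//; last exact: integrable_sfieldM.
rewrite -RintegralD//; first last.
- exact: integrable_sfieldM.
- have := integrable_sfieldM (c *: g) k; apply: eq_integrable => // z _ /=.
  by rewrite mulrA.
by apply: eq_Rintegral => z _; rewrite mulrA -mulrDl.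
Qed.

Lemma L2ipC u v : L2ip u v = L2ip v u.
Proof.
by apply: eq_Rintegral => z _; rewrite mulrC [X in _ + X]mulrC.
Qed.

Lemma L2ip_inner : inner_product_on setT (@L2ip R L).
Proof.
have hl c u u' v : L2ip (c *: u + u') v = c * L2ip u v + L2ip u' v.
  by rewrite !L2ipE !Rintegral_sfieldZDl; lra.
split.
- split=> v _ c u u' _ _; first exact: hl.
  by rewrite L2ipC hl (L2ipC u) (L2ipC u').
- by move=> u v _ _; exact: L2ipC.
- by move=> u _; apply: Rintegral_ge0 => z _; rewrite addr_ge0// -expr2 sqr_ge0.
- by move=> u _ u0; rewrite /L2norm u0 sqrtr0.
Qed.

Lemma subspaceT : Defs.subspace (@setT (vfield L)). Proof. by []. Qed.

End L2.

(** * Norms of Bochner integrals *)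

Section Bochner.
Context {R : realType} (L : R).
Implicit Types (u v w : vfield L) (f : R -> vfield L).
Implicit Types (s : seq (set (measurableTypeR R) * vfield L)).
Local Notation mu := (@lebesgue_measure R).

Lemma L2norm_ge0 u : 0 <= L2norm u.
Proof. exact: sqrtr_ge0. Qed.

Lemma L2normD_le u v : L2norm (u + v) <= L2norm u + L2norm v.
Proof. exact: (normD_le (@subspaceT R L) (@L2ip_inner R L)). Qed.

Lemma L2norm_sqr u : L2norm u ^+ 2 = L2ip u u.
Proof. exact: (norm_sqr (@L2ip_inner R L)). Qed.

Lemma L2CauchySchwarz u v : `|L2ip u v| <= L2norm u * L2norm v.
Proof. exact: (ip_CauchySchwarz (@subspaceT R L) (@L2ip_inner R L)). Qed.

Lemma L2ipZDl c u u' v : L2ip (c *: u + u') v = c * L2ip u v + L2ip u' v.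
Proof. exact: (ipZDl (@L2ip_inner R L)). Qed.

Lemma L2ip0l v : L2ip 0 v = 0.
Proof. by have := L2ipZDl 1 0 0 v; rewrite scale1r addr0 mul1r; lra. Qed.

Lemma L2norm0 : L2norm (0 : vfield L) = 0.
Proof. by rewrite /L2norm L2ip0l sqrtr0. Qed.

Lemma L2normZ c u : L2norm (c *: u) = `|c| * L2norm u.
Proof.
have L2ipZl w v : L2ip (c *: w) v = c * L2ip w v.
  by rewrite -[c *: w]addr0 L2ipZDl L2ip0l addr0.
by rewrite /L2norm L2ipZl L2ipC L2ipZl mulrA -expr2 sqrtrM ?sqr_ge0// sqrtr_sqr.
Qed.

Lemma L2normN u : L2norm (- u) = L2norm u.
Proof. by rewrite -scaleN1r L2normZ normrN1 mul1r. Qed.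

Lemma L2norm_dist u v : `|L2norm u - L2norm v| <= L2norm (u - v).
Proof.
have := L2normD_le (u - v) v; have := L2normD_le (v - u) u.
by rewrite !subrK -(opprB u v) L2normN ler_norml; lra.
Qed.

Lemma L2norm_le_sub u v : L2norm u <= L2norm (v - u) + L2norm v.
Proof.
have := L2norm_dist u v; rewrite -(opprB v) L2normN ler_norml => /andP[_].
by rewrite lerBlDr.
Qed.

Lemma le_amgm (c g : R) : 0 < c -> g <= c / 2 + (2 * c)^-1 * g ^+ 2.
Proof.
move=> c0; rewrite -subr_ge0.
have -> : c / 2 + (2 * c)^-1 * g ^+ 2 - g = (2 * c)^-1 * (g - c) ^+ 2.
  by field; rewrite gt_eqF.
by rewrite mulr_ge0 ?sqr_ge0// invr_ge0 mulr_ge0// ltW.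
Qed.

Lemma L2ip_suml (I : Type) (r : seq I) (c : I -> R) (w : I -> vfield L) v :
  L2ip (\sum_(i <- r) c i *: w i) v = \sum_(i <- r) c i * L2ip (w i) v.
Proof.
elim: r => [|i r IH]; first by rewrite !big_nil L2ip0l.
by rewrite !big_cons L2ipZDl IH.
Qed.

Lemma measurable_sum_seq (I : eqType) (r : seq I) (D : set (measurableTypeR R))
    (F : I -> measurableTypeR R -> R) :
  (forall i, i \in r -> measurable_fun D (F i)) ->
  measurable_fun D (fun t => \sum_(i <- r) F i t).
Proof.
elim: r => [|i r IH] mF.
  by under eq_fun do rewrite big_nil; exact: measurable_cst.
under eq_fun do rewrite big_cons.
apply: measurable_funD; first exact: mF (mem_head _ _).
by apply: IH => j jr; apply: mF; rewrite in_cons jr orbT.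
Qed.

(** Since the sets of a simple function may overlap, its value is not read off
    one pair: the squared norm is expanded by bilinearity into a double sum of
    products of indicators. *)
Lemma measurable_L2norm_simple_val s (D : set (measurableTypeR R)) :
  simple s -> measurable_fun D (fun t => L2norm (simple_val s t)).
Proof.
move=> ss.
have mA p : p \in s -> measurable_fun D (\1_(p.1) : measurableTypeR R -> R).
  by move=> ps; apply: measurable_indic; exact: ss.
pose g t := \sum_(p <- s) \1_(p.1) t *
              \sum_(q <- s) \1_(q.1) t * L2ip q.2 p.2 : R.
rewrite (_ : (fun t => _) = Num.sqrt \o g).
  apply: measurableT_comp.
    by apply: continuous_measurable_fun; exact: sqrt_continuous.
  apply: measurable_sum_seq => p ps; apply: measurable_funM; first exact: mA.
  apply: measurable_sum_seq => q qs; apply: measurable_funM; first exact: mA.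
  exact: measurable_cst.
apply/funext => t; rewrite /L2norm /=; congr Num.sqrt.
rewrite /simple_val L2ip_suml; apply: eq_bigr => p _; congr (_ * _).
by rewrite L2ipC L2ip_suml.
Qed.

Lemma simple_valB s s' : simple s -> simple s' ->
  exists2 r, simple r &
    forall t, simple_val r t = simple_val s t - simple_val s' t.
Proof.
move=> ss ss'; exists (s ++ [seq (p.1, - p.2) | p <- s']).
  move=> p; rewrite mem_cat => /orP[/ss//|/mapP[q /ss' mq ->]//].
move=> t; rewrite /simple_val big_cat/= big_map -sumrN; congr (_ + _).
by apply: eq_bigr => p _; rewrite scalerN.
Qed.

(** The subtracted simple function and the sequence witnessing strong
    measurability are unrelated; the norm is the pointwise limit of the norms of
    the simple functions z_n - s. *)
Lemma measurable_L2norm_sub_simple (I : set (measurableTypeR R)) f s :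
  strongly_measurable I f -> simple s ->
  measurable_fun I (fun t => L2norm (f t - simple_val s t)).
Proof.
move=> [z sz fz] ss.
apply: (@measurable_fun_cvg _ _ _ _
  (fun n t => L2norm (simple_val (z n) t - simple_val s t))).
  move=> n; have [r sr rE] := simple_valB (sz n) ss.
  under eq_fun do rewrite -rE.
  exact: measurable_L2norm_simple_val.
move=> t It.
apply/cvgrPdistC_le => e e0.
apply: filterS (cvgr_le 0 (fz t It) _ e0) => n; apply: le_trans.
apply: le_trans (L2norm_dist _ _) _.
rewrite -L2normN (_ : - _ = f t - simple_val (z n) t)//.
by rewrite opprB opprB addrA subrK.
Qed.

Lemma measurable_L2norm (I : set (measurableTypeR R)) f :
  strongly_measurable I f -> measurable_fun I (fun t => L2norm (f t)).
Proof.
move=> fI; have := @measurable_L2norm_sub_simple I f [::] fI.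
rewrite /simple_val; under eq_fun do rewrite big_nil subr0.
by apply.
Qed.

Section FiniteInterval.
Context (I : set (measurableTypeR R)).
Context (mI : measurable I) (Ify : (mu I < +oo)%E).

Lemma integrable_indic_finite (A : set (measurableTypeR R)) :
  measurable A -> mu.-integrable I (fun t => (\1_A t)%:E).
Proof.
move=> mA; apply/integrableP; split.
  by apply/measurable_EFinP; exact: measurable_indic.
under eq_integral do rewrite gee0_abs ?lee_fin//.
rewrite integral_indic//; apply: le_lt_trans Ify.
by apply: le_measure; rewrite ?inE//; exact: measurableI.
Qed.

Lemma integral_sum_indic s (c : set (measurableTypeR R) * vfield L -> R) :
  simple s ->
  mu.-integrable I (fun t => (\sum_(p <- s) \1_(p.1) t * c p)%:E) /\
  (\int[mu]_(t in I) (\sum_(p <- s) \1_(p.1) t * c p)%:E =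
    (\sum_(p <- s) fine (mu (p.1 `&` I)) * c p)%:E)%E.
Proof.
elim: s => [|p s IH] ss.
  rewrite big_nil; split.
    by under eq_fun do rewrite big_nil; exact: integrable0.
  by under eq_integral do rewrite big_nil; rewrite integral0.
have mp : measurable p.1 by apply: ss; rewrite mem_head.
have [|is1 is2] := IH.
  by move=> q qs; apply: ss; rewrite in_cons qs orbT.
have ip := integrable_indic_finite mp.
have ipc := integrableZr mI (c p) ip.
split.
  rewrite (_ : (fun t => _) = (fun t => (\1_(p.1) t)%:E * (c p)%:E) \+
     (fun t => (\sum_(p <- s) \1_(p.1) t * c p)%:E))%E.
    exact: integrableD.
  by apply/funext => t; rewrite big_cons EFinD EFinM.
under eq_integral do rewrite big_cons EFinD EFinM.
rewrite integralD// is2 integralZr// integral_indic// big_cons EFinD EFinM fineK//.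
have h : (mu (p.1 `&` I) <= mu I)%E.
  by apply: le_measure; rewrite ?inE//; exact: measurableI.
by rewrite ge0_fin_numE//; exact: le_lt_trans Ify.
Qed.

(** By duality, which again avoids making the sets disjoint: with J the integral
    of s, |J|^2 is the integral of the scalar function (s(t), J), at most
    |s(t)| |J|. *)
Lemma L2norm_simple_int_le s : simple s ->
  ((L2norm (simple_int I s))%:E <= \int[mu]_(t in I) (L2norm (simple_val s t))%:E)%E.
Proof.
move=> ss; set J := simple_int I s.
have [->|J0] := eqVneq (L2norm J) 0.
  by apply: integral_ge0 => t _; rewrite lee_fin L2norm_ge0.
have Jpos : 0 < L2norm J by rewrite lt_def J0 L2norm_ge0.
rewrite -(@lee_pmul2r _ (L2norm J)%:E) ?lte_fin//.
rewrite -EFinM -expr2 L2norm_sqr {1}/J /simple_int L2ip_suml.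
have [si <-] := integral_sum_indic (fun p => L2ip p.2 J) ss.
have mS := @measurable_L2norm_simple_val _ I ss.
have mS' : measurable_fun I (fun t => (L2norm (simple_val s t))%:E).
  exact/measurable_EFinP.
have S0 t : I t -> (0 <= (L2norm (simple_val s t))%:E)%E.
  by rewrite lee_fin L2norm_ge0.
have J0' : (0 <= (L2norm J)%:E)%E by rewrite lee_fin L2norm_ge0.
rewrite -(ge0_integralZr mu mI mS' S0 J0').
apply: le_trans (lee_abs _) _.
have msi := measurable_int _ si.
apply: le_trans (le_abse_integral _ mI msi) _.
apply: ge0_le_integral => //.
- exact: measurableT_comp.
- exact: emeasurable_funM mS' (measurable_cst _).
- move=> t _; rewrite -EFinM lee_fin.
  by rewrite -(L2ip_suml s (fun p => \1_(p.1) t)); exact: L2CauchySchwarz.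
Qed.

(** Instead of bounding |J| by the integral of |f| and using the Cauchy-Schwarz
    inequality in time, the pointwise bound |f| <= c / 2 + |f|^2 / (2 c) is
    integrated before the limit along the simple functions, for an arbitrary
    c > 0; with c = |J| / mu(I) the first term integrates to |J| / 2, which is
    absorbed on the left. *)
Lemma L2norm_bochner_int_le f J : (0 < mu I)%E -> strongly_measurable I f ->
  mu.-integrable I (fun t => (L2norm (f t) ^+ 2)%:E) -> is_bochner_int I f J ->
  L2norm J ^+ 2 <= fine (mu I) * \int[mu]_(t in I) (L2norm (f t) ^+ 2).
Proof.
move=> I0 mf if2 [s [ss fs Js]].
set G := \int[mu]_(t in I) _; set k := fine (mu I).
have G0 : 0 <= G by apply: Rintegral_ge0 => t _; exact: sqr_ge0.
have GE : (\int[mu]_(t in I) (L2norm (f t) ^+ 2)%:E = G%:E)%E.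
  by rewrite fineK//; exact: integrable_fin_num.
have kpos : 0 < k by rewrite fine_gt0// I0.
have k0 := ltW kpos.
have kE : (mu I = k%:E)%E by rewrite fineK// ge0_fin_numE.
have [->|J0] := eqVneq (L2norm J) 0; first by rewrite expr0n mulr_ge0.
have Jpos : 0 < L2norm J by rewrite lt_def J0 L2norm_ge0.
have bound c : 0 < c -> L2norm J <= c / 2 * k + (2 * c)^-1 * G.
  move=> c0; apply/ler_addgt0Pr => e e0.
  have e20 : 0 < e / 2 by rewrite divr_gt0.
  have mfL := measurable_L2norm mf.
  have mfL2 : measurable_fun I (fun t => L2norm (f t) ^+ 2) by exact: measurable_funX.
  have [fin /(cvgr_le 0) /(_ _ e20) fs'] : _ /\ _ := (fine_cvgP _ 0).1 fs.
  have Js' := cvgr_le 0 Js _ e20.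
  have /filter_ex[n [finn fsn Jsn]] : \forall n \near \oo, [/\
      (\int[mu]_(t in I) (L2norm (f t - simple_val (s n) t))%:E)%E \is a fin_num,
      fine (\int[mu]_(t in I) (L2norm (f t - simple_val (s n) t))%:E)%E <= e / 2
    & L2norm (J - simple_int I (s n)) <= e / 2].
    by near=> n; split; near: n; [exact: fin|exact: fs'|exact: Js'].
  have msn := measurable_L2norm_sub_simple mf (ss n).
  have : L2norm (simple_int I (s n)) <= e / 2 + (c / 2 * k + (2 * c)^-1 * G).
    rewrite -lee_fin; apply: le_trans (L2norm_simple_int_le (ss n)) _.
    have h : (\int[mu]_(t in I) (L2norm (f t - simple_val (s n) t))%:E +
       ((c / 2 * k)%:E + ((2 * c)^-1 * G)%:E) <=
       (e / 2 + (c / 2 * k + (2 * c)^-1 * G))%:E)%E.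
      by rewrite -[X in (X + _ <= _)%E](fineK finn) -!EFinD lee_fin; lra.
    apply: le_trans h.
    rewrite [X in (_ + (_ + X))%E]EFinM -GE [X in (_ + (X + _))%E]EFinM -kE.
    rewrite -integral_cst// -ge0_integralZl_EFin//; last 3 first.
    - by move=> t _; rewrite lee_fin sqr_ge0.
    - exact/measurable_EFinP.
    - by rewrite invr_ge0 mulr_ge0// ltW.
    have mc : measurable_fun I (fun t => ((2 * c)^-1)%:E * (L2norm (f t) ^+ 2)%:E)%E.
      by apply: (emeasurable_funM (measurable_cst _)); exact/measurable_EFinP.
    have c2 : 0 <= (2 * c)^-1 by rewrite invr_ge0 mulr_ge0// ltW.
    rewrite -ge0_integralD//; last 2 first.
    - by move=> t _; rewrite lee_fin divr_ge0// ltW.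
    - by move=> t _; rewrite -EFinM lee_fin mulr_ge0// sqr_ge0.
    rewrite -ge0_integralD//; first last.
    - by apply: emeasurable_funD => //; exact: measurable_cst.
    - move=> t _; rewrite -EFinM -EFinD lee_fin; apply: addr_ge0.
        by rewrite divr_ge0// ltW.
      by rewrite mulr_ge0// sqr_ge0.
    - exact/measurable_EFinP.
    - by move=> t _; rewrite lee_fin L2norm_ge0.
    apply: ge0_le_integral => //.
    - by move=> t _; rewrite lee_fin L2norm_ge0.
    - by apply/measurable_EFinP; exact: measurable_L2norm_simple_val.
    - apply: emeasurable_funD; first exact/measurable_EFinP.
      by apply: emeasurable_funD => //; exact: measurable_cst.
    - move=> t _; rewrite -EFinM -!EFinD lee_fin.
      apply: (le_trans (L2norm_le_sub (simple_val (s n) t) (f t))).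
      by rewrite lerD2l le_amgm.
  have := L2normD_le (J - simple_int I (s n)) (simple_int I (s n)).
  rewrite subrK => h1 h2; apply: (le_trans h1).
  by rewrite [in leRHS](splitr e) [leRHS]addrC -[leRHS]addrA lerD.
have := bound (L2norm J / k) (divr_gt0 Jpos kpos).
have -> : L2norm J / k / 2 * k + (2 * (L2norm J / k))^-1 * G =
  L2norm J / 2 + k * G / L2norm J / 2 by field; rewrite J0 (gt_eqF kpos).
rewrite [leLHS]splitr lerD2l ler_pM2r ?invr_gt0//.
by rewrite ler_pdivlMr// -expr2.
Unshelve. all: by end_near.
Qed.

End FiniteInterval.

End Bochner.

(** * Time averages of the forcing *)

Section TimeAverage.
Context {R : realType} (L : R).
Implicit Types (f : R -> vfield L).
Local Notation mu := (@lebesgue_measure R).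

Lemma strongly_measurableS (I I' : set R) f :
  I' `<=` I -> strongly_measurable I f -> strongly_measurable I' f.
Proof. by move=> I'I [s ss fs]; exists s => // t /I'I; exact: fs. Qed.

Lemma time_average_le (k : R) f m : 0 < k -> (0 < m)%N ->
  strongly_measurable `[m.-1%:R * k, m%:R * k] f ->
  mu.-integrable `[m.-1%:R * k, m%:R * k] (fun t => (L2norm (f t) ^+ 2)%:E) ->
  k * L2norm (time_average k f m) ^+ 2 <=
  \int[mu]_(t in `[m.-1%:R * k, m%:R * k]) (L2norm (f t) ^+ 2).
Proof.
move=> k0 m0 fm f2.
have muI : mu `[m.-1%:R * k, m%:R * k]%classic = k%:E.
  rewrite lebesgue_measure_itv/= lte_fin ltr_pM2r// ltr_nat prednK// leqnn.
  rewrite -EFinB -mulrBl; congr (_%:E).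
  by rewrite -{1}(prednK m0) -addn1 natrD addrC addKr mul1r.
rewrite /time_average L2normZ exprMn mulrA real_normK ?num_real//.
have -> : k * k^-1 ^+ 2 = k^-1 by field; rewrite gt_eqF.
rewrite ler_pdivrMl// /bochner_int.
(* without a Bochner integral the average is the default value 0 *)
case: xgetP => [J -> HJ|nJ]; last first.
  rewrite L2norm0 expr0n (mulr_ge0 (ltW k0))//.
  by apply: Rintegral_ge0 => t _; exact: sqr_ge0.
have := L2norm_bochner_int_le _ _ _ fm f2 HJ; rewrite muI.
by apply=> //; rewrite ?ltry ?lte_fin.
Qed.

Lemma sum_time_average_le (T : R) f N n : in_L2L2 T f -> 0 < T -> (0 < N)%N ->
  (n <= N)%N ->
  \sum_(1 <= m < n.+1) T / N%:R * L2norm (time_average (T / N%:R) f m) ^+ 2 <=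
  \int[mu]_(t in `[0, n%:R * (T / N%:R)]) (L2norm (f t) ^+ 2).
Proof.
move=> [fm f2y _] T0 N0; set k := T / N%:R.
have k0 : 0 < k by rewrite divr_gt0// ltr0n.
have NkT : N%:R * k = T by rewrite mulrC divfK// pnatr_eq0 -lt0n.
have f2 : mu.-integrable `[0, T] (fun t => (L2norm (f t) ^+ 2)%:E).
  apply/integrableP; split.
    by apply/measurable_EFinP; apply: measurable_funX; exact: measurable_L2norm.
  by under eq_integral do rewrite gee0_abs ?lee_fin ?sqr_ge0//.
elim: n => [|n IH] nN.
  by rewrite big_geq//; apply: Rintegral_ge0 => t _; exact: sqr_ge0.
have subI : `[n%:R * k, n.+1%:R * k] `<=` `[0, T].
  apply: subset_itv; rewrite bnd_simp; first by rewrite mulr_ge0// ltW.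
  by rewrite -NkT ler_pM2r// ler_nat.
have subI' : `[0, n.+1%:R * k] `<=` `[0, T].
  by apply: subset_itv; rewrite bnd_simp// -NkT ler_pM2r// ler_nat.
rewrite big_nat_recr//=.
have kn0 : 0 <= n%:R * k by rewrite mulr_ge0// ltW.
have knS : n%:R * k <= n.+1%:R * k by rewrite ler_pM2r// ler_nat.
have f2n : mu.-integrable `[0, n.+1%:R * k] (fun t => (L2norm (f t) ^+ 2)%:E).
  by apply: integrableS f2 => //.
have f2m : mu.-integrable `[n%:R * k, n.+1%:R * k] (fun t => (L2norm (f t) ^+ 2)%:E).
  by apply: integrableS f2 => //.
have f2m' : mu.-integrable `]n%:R * k, n.+1%:R * k] (fun t => (L2norm (f t) ^+ 2)%:E).
  by apply: integrableS f2m => //; apply: subset_itvr; rewrite bnd_simp.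
rewrite addrC -lerBrDr.
have := @Rintegral_itvB _ (fun t => L2norm (f t) ^+ 2)
  (BLeft 0) (BRight (n.+1%:R * k)) (n%:R * k) f2n.
rewrite !bnd_simp Rintegral_itv_obnd_cbnd// => /(_ kn0 knS) h.
apply: (le_trans (time_average_le k0 (ltn0Sn n) (strongly_measurableS subI fm) f2m)).
by rewrite -h lerD2l lerN2; apply: IH; exact: ltnW.
Qed.

End TimeAverage.

(** * One step of the scheme *)

Section Step.
Context {R : realType} (L : R).

(** The weight 1 / 4 is chosen so that three such terms use up less than x^2. *)
Lemma young_absorb (k A B x : R) : 0 <= k -> `|B| <= A * x ->
  2 * k * `|B| <= x ^+ 2 / 4 + 4 * (k * A) ^+ 2.
Proof.
move=> k0 BAx; have k20 : 0 <= 2 * k by rewrite mulr_ge0.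
apply: le_trans (ler_wpM2l k20 BAx) _; rewrite -subr_ge0.
have -> : x ^+ 2 / 4 + 4 * (k * A) ^+ 2 - 2 * k * (A * x) = (x / 2 - 2 * (k * A)) ^+ 2.
  by field.
exact: sqr_ge0.
Qed.

(** The force against the previous iterate: the weights leave half of the
    dissipation 2 k nu q^2 and produce the term d0^2 / nu of d6. *)
Lemma young_force (k nu d F q B : R) : 0 <= k -> 0 < nu -> `|B| <= F * (d * q) ->
  2 * k * `|B| <= k * nu * q ^+ 2 + k * (d ^+ 2 / nu) * F ^+ 2.
Proof.
move=> k0 nu0 BF; have k20 : 0 <= 2 * k by rewrite mulr_ge0.
apply: le_trans (ler_wpM2l k20 BF) _; rewrite -subr_ge0.
have -> : k * nu * q ^+ 2 + k * (d ^+ 2 / nu) * F ^+ 2 - 2 * k * (F * (d * q)) =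
  k / nu * (nu * q - d * F) ^+ 2 by field; rewrite gt_eqF.
by rewrite mulr_ge0 ?sqr_ge0// divr_ge0// ltW.
Qed.

Context (G : galerkin L) (h : nat) (k nu alpha delta : R) (p w g : vfield L).
Local Notation ip := (iph G h).
Local Notation nrm := (normh G h).
Local Notation W := (Vh G h).
Let E u := L2norm u ^+ 2 + alpha ^+ 2 * nrm u ^+ 2.
Context (k0 : 0 < k) (nu0 : 0 < nu).
Context (Dp : DAh G h p) (Dw : DAh G h w).
Context (scheme : forall v, W v ->
  k^-1 * L2ip (w - p) v + alpha ^+ 2 / k * L2ip (Ah G h w - Ah G h p) v
  + nu * ip p v + bh G h p p v = L2ip g v).
Context (stab : 4 * nu * k * Sh G h ^+ 2 <= 1 - delta).
Context (small : 8 * k * S1h G h ^+ 2 * L2norm p ^+ 2 <= nu * delta).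

Let Wp : W p := DAh_Vh Dp.
Let Ww : W w := DAh_Vh Dw.
Let Wwp : W (w - p) := subspaceB (Vh_subspace G h) Ww Wp.
Let Dwp : DAh G h (w - p) := subspaceB (DAh_subspace G h) Dw Dp.

Lemma L2ip_AhB v : DAh G h v -> L2ip (Ah G h w - Ah G h p) v = ip (w - p) v.
Proof.
move=> Dv; rewrite (ipBl (@L2ip_inner R L))// (AhE Dw Dv) (AhE Dp Dv).
by rewrite (ipBl (iph_inner G h))//; exact: DAh_Vh.
Qed.

(** The inverse inequality ||v||_h <= S(h) |v| turns ||w - p||_h into |w - p|;
    this is why an explicit viscous term needs k S(h)^2 to be small. *)
Lemma viscous_bound :
  2 * k * nu * `|ip p (w - p)| <=
  L2norm (w - p) ^+ 2 / 4 + k * nu * (1 - delta) * nrm p ^+ 2.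
Proof.
have B : `|ip p (w - p)| <= Sh G h * nrm p * L2norm (w - p).
  apply: le_trans (ip_CauchySchwarz (Vh_subspace G h) (iph_inner G h) Wp Wwp) _.
  rewrite [leRHS]mulrAC [leRHS]mulrC ler_wpM2l ?sqrtr_ge0//.
  exact: normh_le_L2norm.
have knu0 : 0 <= k * nu by rewrite mulr_ge0// ltW.
have := young_absorb knu0 B; rewrite mulrA => /le_trans; apply; rewrite lerD2l.
have -> : 4 * (k * nu * (Sh G h * nrm p)) ^+ 2 =
  k * nu * (4 * nu * k * Sh G h ^+ 2) * nrm p ^+ 2 by ring.
by rewrite ler_wpM2r ?sqr_ge0// ler_wpM2l.
Qed.

Lemma convective_bound :
  2 * k * `|bh G h p p (w - p)| <=
  L2norm (w - p) ^+ 2 / 4 + k * nu * (delta / 2) * nrm p ^+ 2.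
Proof.
have B := bh_le_L2norm Wp Wwp.
have := young_absorb (ltW k0) B => /le_trans; apply; rewrite lerD2l.
have -> : 4 * (k * (S1h G h * L2norm p * nrm p)) ^+ 2 =
  k * (8 * k * S1h G h ^+ 2 * L2norm p ^+ 2 / 2) * nrm p ^+ 2 by field.
rewrite ler_wpM2r ?sqr_ge0// -[leRHS]mulrA ler_wpM2l ?(ltW k0)// [leRHS]mulrA.
by rewrite ler_wpM2r.
Qed.

Lemma force_bound :
  2 * k * `|L2ip g (w - p)| <= L2norm (w - p) ^+ 2 / 4 + 4 * k ^+ 2 * L2norm g ^+ 2.
Proof.
have := young_absorb (ltW k0) (L2CauchySchwarz g (w - p)).
by rewrite exprMn mulrA.
Qed.

(** Obtained by testing with 2 k (w - p). *)
Lemma increment_step :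
  L2norm (w - p) ^+ 2 + alpha ^+ 2 * nrm (w - p) ^+ 2 <=
  k * nu * (1 - delta / 2) * nrm p ^+ 2 + 4 * k ^+ 2 * L2norm g ^+ 2.
Proof.
have S : 2 * L2norm (w - p) ^+ 2 + 2 * (alpha ^+ 2 * nrm (w - p) ^+ 2)
    + 2 * k * nu * ip p (w - p) + 2 * k * bh G h p p (w - p)
    = 2 * k * L2ip g (w - p).
  rewrite -(scheme Wwp) (L2ip_AhB Dwp) -L2norm_sqr -(norm_sqr (iph_inner G h) Wwp).
  by rewrite -/(nrm _); field; rewrite gt_eqF.
have k20 : 0 <= 2 * k by rewrite mulr_ge0 ?(ltW k0).
have kn20 : 0 <= 2 * k * nu by rewrite mulr_ge0// ltW.
have b1 := ler_wpM2l kn20 (lerNnormlW (lexx `|ip p (w - p)|)).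
have b2 := ler_wpM2l k20 (lerNnormlW (lexx `|bh G h p p (w - p)|)).
have b3 := ler_wpM2l k20 (ler_norm (L2ip g (w - p))).
have b1' := viscous_bound.
have b2' := convective_bound.
have b3' := force_bound.
have x0 := sqr_ge0 (L2norm (w - p)).
have y0 : 0 <= alpha ^+ 2 * nrm (w - p) ^+ 2 by rewrite mulr_ge0 ?sqr_ge0.
lra.
Qed.

(** Obtained by testing with 2 k w. *)
Lemma energy_step :
  E w + k * nu * (delta / 2) * nrm p ^+ 2 <=
  E p + (d0 G ^+ 2 / nu + 4 * k) * (k * L2norm g ^+ 2).
Proof.
have Dip : 2 * ip (w - p) w = nrm w ^+ 2 - nrm p ^+ 2 + nrm (w - p) ^+ 2.
  have := ip_increment (Vh_subspace G h) (iph_inner G h) Ww Wp.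
  by rewrite -!/(nrm _).
have DL2 := ip_increment (@subspaceT R L) (@L2ip_inner R L) I I :
  2 * L2ip (w - p) w = L2norm w ^+ 2 - L2norm p ^+ 2 + L2norm (w - p) ^+ 2.
have ipw : ip p w = nrm p ^+ 2 + ip p (w - p).
  by rewrite (ipBr (iph_inner G h) Ww Wp Wp) (norm_sqr (iph_inner G h) Wp) addrC subrK.
have bw : bh G h p p w = bh G h p p (w - p).
  have [/(_ p Wp)[_ /(_ p Wp 1 (w - p) p Wwp Wp)]] := bh_trilinear G h.
  by rewrite scale1r subrK mul1r (bh_skew Wp Wp) addr0.
have gw : L2ip g w = L2ip g p + L2ip g (w - p).
  by rewrite (ipBr (@L2ip_inner R L))// addrC subrK.
have S : 2 * L2ip (w - p) w + alpha ^+ 2 * (2 * ip (w - p) w)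
    + 2 * k * nu * (nrm p ^+ 2 + ip p (w - p)) + 2 * k * bh G h p p (w - p)
    = 2 * k * (L2ip g p + L2ip g (w - p)).
  by rewrite -gw -(scheme Ww) (L2ip_AhB Dw) ipw bw; field; rewrite gt_eqF.
have k20 : 0 <= 2 * k by rewrite mulr_ge0 ?(ltW k0).
have kn20 : 0 <= 2 * k * nu by rewrite mulr_ge0// ltW.
have b1 := ler_wpM2l kn20 (lerNnormlW (lexx `|ip p (w - p)|)).
have b2 := ler_wpM2l k20 (lerNnormlW (lexx `|bh G h p p (w - p)|)).
have b3 := ler_wpM2l k20 (ler_norm (L2ip g (w - p))).
have b4 := ler_wpM2l k20 (ler_norm (L2ip g p)).
have b1' := viscous_bound.
have b2' := convective_bound.
have b3' := force_bound.
have b4' : 2 * k * `|L2ip g p| <=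
    k * nu * nrm p ^+ 2 + k * (d0 G ^+ 2 / nu) * L2norm g ^+ 2.
  apply: young_force => //; first exact: ltW.
  apply: le_trans (L2CauchySchwarz g p) _.
  by rewrite ler_wpM2l ?L2norm_ge0//; exact: L2norm_le_normh.
have x0 := sqr_ge0 (L2norm (w - p)).
have y0 : 0 <= alpha ^+ 2 * nrm (w - p) ^+ 2 by rewrite mulr_ge0 ?sqr_ge0.
rewrite DL2 Dip in S.
rewrite /E; lra.
Qed.

End Step.

(** * The energy bounds *)

Lemma L2norm_orth_proj_le (R : realType) (L : R) (W : set (vfield L)) u p :
  is_orth_proj W u p -> L2norm p <= L2norm u.
Proof.
move=> [Wp /(_ p Wp) up0].
have := ip_increment (@subspaceT R L) (@L2ip_inner R L) (u := p) (v := u) I I.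
rewrite -!/(L2norm _) => D.
have : L2ip (p - u) p = 0.
  rewrite (ipBl (@L2ip_inner R L))// -[LHS]opprB.
  by rewrite -(ipBl (@L2ip_inner R L))// up0 oppr0.
move=> D0; rewrite D0 mulr0 in D.
rewrite -(@ler_pXn2r _ 2)// ?nnegrE ?L2norm_ge0//.
have := sqr_ge0 (L2norm (p - u)); lra.
Qed.

Theorem lemma4p3 (R : realType) (L nu T alpha delta : R)
    (u0 : vfield L) (f : R -> vfield L) (G : galerkin L) (h N : nat)
    (u : nat -> vfield L) :
  0 < L -> 0 < nu -> 0 < T -> in_V u0 -> in_L2L2 T f -> (1 <= N)%N ->
  0 < delta < 1 -> 0 <= alpha ->
  let k := T / N%:R in
  let intf2 := \int[lebesgue_measure]_(s in `[0, T]) (L2norm (f s) ^+ 2) in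
  let d6 := L2norm u0 ^+ 2 + alpha ^+ 2 * Vnorm u0 ^+ 2
            + (d0 G ^+ 2 / nu + 4 * T) * intf2 in
  (forall m, (m <= N)%N -> DAh G h (u m)) ->
  is_orth_proj (DAh G h) u0 (u 0%N) ->
  normh G h (u 0%N) <= Vnorm u0 ->
  (forall m, (1 <= m <= N)%N -> forall v, Vh G h v ->
     k^-1 * L2ip (u m - u m.-1) v
     + alpha ^+ 2 / k * L2ip (Ah G h (u m) - Ah G h (u m.-1)) v
     + nu * iph G h (u m.-1) v
     + bh G h (u m.-1) (u m.-1) v
     = L2ip (time_average k f m) v) ->
  k * Sh G h ^+ 2 <= (1 - delta) / (4 * nu) ->
  (d6 != 0 -> k * S1h G h ^+ 2 <= nu * delta / (8 * d6)) ->
  [/\ forall m, (1 <= m <= N)%N ->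
        L2norm (u m) ^+ 2 + alpha ^+ 2 * normh G h (u m) ^+ 2 <= d6,
      forall r, (1 <= r <= N)%N ->
        k * \sum_(1 <= m < r.+1) normh G h (u m.-1) ^+ 2
          <= 2 * d6 / (nu * delta)
    & \sum_(1 <= m < N.+1)
        (L2norm (u m - u m.-1) ^+ 2
         + alpha ^+ 2 * normh G h (u m - u m.-1) ^+ 2)
      <= (2 - delta) / delta * d6 + 4 * T * intf2].
Proof.
move=> _ nu0 T0 _ fL2 N1 /andP[delta0 delta1] _ k intf2 d6.
move=> Du pu0 nu_u0 scheme stab small.
have k0 : 0 < k by rewrite divr_gt0// ltr0n.
have NkT : N%:R * k = T by rewrite mulrC divfK// pnatr_eq0 -lt0n.
have kT : k <= T by rewrite -NkT ler_peMl ?(ltW k0)// ler1n.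
pose E v := L2norm v ^+ 2 + alpha ^+ 2 * normh G h v ^+ 2.
pose F m := k * L2norm (time_average k f m) ^+ 2.
have F0 m : 0 <= F m by rewrite mulr_ge0 ?sqr_ge0// ltW.
have sumF n : (n <= N)%N -> \sum_(1 <= m < n.+1) F m <= intf2.
  move=> nN; apply: (@le_trans _ _ (\sum_(1 <= m < N.+1) F m)).
    rewrite (@big_cat_nat _ _ _ n.+1 1 N.+1)//= lerDl.
    by apply: sumr_ge0.
  by have := sum_time_average_le fL2 T0 N1 (leqnn N); rewrite -/k NkT.
have C0 : 0 <= d0 G ^+ 2 / nu by rewrite divr_ge0 ?sqr_ge0// ltW.
have E0 : E (u 0%N) <= L2norm u0 ^+ 2 + alpha ^+ 2 * Vnorm u0 ^+ 2.
  apply: lerD.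
    by rewrite ler_pXn2r ?nnegrE ?L2norm_ge0// (L2norm_orth_proj_le pu0).
  by rewrite ler_wpM2l ?sqr_ge0// ler_pXn2r ?nnegrE ?sqrtr_ge0.
have stab' : 4 * nu * k * Sh G h ^+ 2 <= 1 - delta.
  by move: stab; rewrite ler_pdivlMr ?mulr_gt0//; lra.
have smallE m : E (u m) <= d6 -> 8 * k * S1h G h ^+ 2 * L2norm (u m) ^+ 2 <= nu * delta.
  move=> Em; have Lm : L2norm (u m) ^+ 2 <= d6.
    by apply: le_trans Em; rewrite lerDl mulr_ge0 ?sqr_ge0.
  have nd0 : 0 <= nu * delta by rewrite mulr_ge0// ltW.
  (* when d6 vanishes the bound on k S_1(h)^2 is void, but |u m| vanishes too *)
  have [d60|d6n0] := eqVneq d6 0.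
    have -> : L2norm (u m) ^+ 2 = 0.
      by apply/eqP; rewrite eq_le sqr_ge0 andbT -d60.
    by rewrite mulr0.
  have d6pos : 0 < d6 by rewrite lt_def d6n0 (le_trans _ Lm)// sqr_ge0.
  have kS0 : 0 <= 8 * k * S1h G h ^+ 2 by rewrite mulr_ge0 ?sqr_ge0// mulr_ge0// ltW.
  apply: le_trans (ler_wpM2l kS0 Lm) _.
  by have := small d6n0; rewrite ler_pdivlMr ?mulr_gt0//; lra.
have data_le n : (n <= N)%N ->
    E (u 0%N) + (d0 G ^+ 2 / nu + 4 * k) * \sum_(1 <= m < n.+1) F m <= d6.
  move=> nN; apply: lerD => //; apply: ler_pM; rewrite ?sumr_ge0 ?sumF//.
    by rewrite addr_ge0// mulr_ge0// ltW.
  by rewrite lerD2l ler_pM2l.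
have nud0 : 0 < nu * (delta / 2) by rewrite mulr_gt0// divr_gt0.
pose Q n := \sum_(1 <= m < n.+1) normh G h (u m.-1) ^+ 2.
have Q0 n : 0 <= Q n by apply: sumr_ge0 => m _; exact: sqr_ge0.
have energy n : (n <= N)%N ->
    E (u n) + nu * (delta / 2) * (k * Q n) <=
    E (u 0%N) + (d0 G ^+ 2 / nu + 4 * k) * \sum_(1 <= m < n.+1) F m.
  elim: n => [|n IH] nN.
    by rewrite /Q !big_geq// !mulr0 !addr0.
  have nN' := ltnW nN; have IHn := IH nN'.
  have En : E (u n) <= d6.
    apply: le_trans (data_le n nN'); apply: le_trans IHn.
    by rewrite lerDl mulr_ge0 ?(ltW nud0)// mulr_ge0// ltW.
  have := energy_step k0 nu0 (Du n nN') (Du n.+1 nN) (scheme n.+1 nN) stab'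
    (smallE n En).
  rewrite -/(E _) -/(E _) -/(F n.+1).
  rewrite /Q big_nat_recr//= -/(Q n) [X in _ -> _ <= _ + _ * X]big_nat_recr//=.
  by move: IHn; rewrite -/(Q n); lra.
have Ed6 n : (n <= N)%N -> E (u n) <= d6.
  move=> nN; apply: le_trans (data_le n nN); apply: le_trans (energy n nN).
  by rewrite lerDl mulr_ge0 ?(ltW nud0)// mulr_ge0// ltW.
have sumQ n : (n <= N)%N -> k * Q n <= 2 * d6 / (nu * delta).
  move=> nN; rewrite ler_pdivlMr ?mulr_gt0//.
  have := le_trans (energy n nN) (data_le n nN).
  have : 0 <= E (u n) by rewrite addr_ge0 ?sqr_ge0// mulr_ge0 ?sqr_ge0.
  by lra.
split.
- by move=> m /andP[_ mN]; exact: Ed6.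
- by move=> r /andP[_ rN]; exact: sumQ.
have incr m : (1 <= m < N.+1)%N ->
    L2norm (u m - u m.-1) ^+ 2 + alpha ^+ 2 * normh G h (u m - u m.-1) ^+ 2 <=
    nu * (1 - delta / 2) * (k * normh G h (u m.-1) ^+ 2) + 4 * k * F m.
  rewrite ltnS => /andP[m1 mN].
  have mN' : (m.-1 <= N)%N by rewrite (leq_trans (leq_pred _)).
  have hm : (1 <= m <= N)%N by rewrite m1.
  have := increment_step k0 nu0 (Du _ mN') (Du m mN) (scheme m hm) stab'
    (smallE _ (Ed6 _ mN')).
  by rewrite /F; lra.
rewrite (le_trans (ler_sum_nat incr))// big_split/= -3!mulr_sumr -/(Q N).
apply: lerD.
  have c0 : 0 <= nu * (1 - delta / 2) by rewrite mulr_ge0 ?(ltW nu0)//; lra.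
  apply: le_trans (ler_wpM2l c0 (sumQ N (leqnn N))) _.
  rewrite le_eqVlt; apply/orP; left; apply/eqP.
  by field; rewrite !gt_eqF.
apply: ler_pM; [|by apply: sumr_ge0| |exact: sumF].
  by rewrite mulr_ge0// ltW.
by rewrite ler_pM2l.
Qed.
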